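(* The set $\mathfrak{I} = \{ I \subseteq \mathbb{3}^X : Ann^{2}(I) = I \}$ of closed sets of $\mathbb{3}^{X}$ with respect to $Ann^{2}$ is a Boolean algebra with respect to the operations \begin{align*} \neg I & = Ann(I) \\ I_{1} \wedge I_{2} & = I_{1} \cap I_{2} \\ I_{1} \vee I_{2} & = Ann( Ann(I_{1}) \cap Ann(I_{2})) \end{align*} and $\{ {\bf U} \}$ and $\mathbb{3}^{X}$ as the constants $0$ and $1$ respectively. Moreover, $\mathfrak{I} \cong \mathbb{2}^{X}$ and is therefore complete.
   Context: $\mathbb{3} = \{T, F, U\}$ is McCarthy's three-valued logic: $\neg T = F$, $\neg F = T$, $\neg U = U$; $T \wedge y = y$, $F \wedge y = F$, $U \wedge y = U$; $T \vee y = T$, $F \vee y = y$, $U \vee y = U$. For a set $X$, $\mathbb{3}^{X}$ carries the pointwise operations, with constant ${\bf U}$ identically $U$; $\mathbb{2}^X$ is the power-set Boolean algebra. For $a \in \mathbb{3}^X$, $Ann(a) = \{ \alpha \in \mathbb{3}^X : (\alpha \wedge a) \vee (\neg \alpha \wedge a) = {\bf U} \}$, and for $S \subseteq \mathbb{3}^X$, $Ann(S) = \bigcap_{a \in S} Ann(a)$; $Ann^2 = Ann \circ Ann$. *)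

(* Defs.v *)
From mathcomp Require Import all_boot all_order all_classical.

Set Implicit Arguments.
Unset Strict Implicit.
Unset Printing Implicit Defensive.

Local Open Scope classical_set_scope.

(* McCarthy's logic is evaluated from left to right, so [mc_and] and [mc_or] are
   not commutative: [mc_and F3 U3 = F3] but [mc_and U3 F3 = U3]. *)
Variant three := T3 | F3 | U3.

Definition mc_neg (x : three) : three :=
  match x with T3 => F3 | F3 => T3 | U3 => U3 end.

Definition mc_and (x y : three) : three :=
  match x with T3 => y | F3 => F3 | U3 => U3 end.

Definition mc_or (x y : three) : three :=
  match x with T3 => T3 | F3 => y | U3 => U3 end.

Section Pointwise.
Context {X : Type}.
Implicit Types (a b : X -> three) (S : set (X -> three)).

Definition pw_neg a : X -> three := fun x => mc_neg (a x).
Definition pw_and a b : X -> three := fun x => mc_and (a x) (b x).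
Definition pw_or a b : X -> three := fun x => mc_or (a x) (b x).
Definition pw_U : X -> three := fun=> U3.

Definition Ann1 a : set (X -> three) :=
  [set alpha | pw_or (pw_and alpha a) (pw_and (pw_neg alpha) a) = pw_U].

(* The intersection is taken inside [X -> three]: [Ann set0 = setT]. *)
Definition Ann S : set (X -> three) := \bigcap_(a in S) Ann1 a.

End Pointwise.

Definition closed_sets (X : Type) : set (set (X -> three)) :=
  [set I | Ann (Ann I) = I].
Arguments closed_sets X _ : clear implicits.

Definition closed_type (X : Type) : Type := set_type (closed_sets X).

Definition carrier (X : Type) (I : closed_type X) : set (X -> three) := sval I.

(* Joins and meets are required for all families, including the empty one. *)
Definition complete_lattice (d : Order.disp_t) (L : latticeType d) : Prop :=
  forall F : set L, supremums F !=set0 /\ infimums F !=set0.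

(* Main.v *)
Require Import Defs.
From HB Require Import structures.
From mathcomp Require Import all_boot all_order all_classical.

(** Evaluating the four relevant cases shows that [alpha] annihilates [a] iff at
   every point one of the two is undefined. Hence [Ann S] consists of the functions
   that are undefined wherever some element of [S] is defined, and the closed sets
   are exactly the sets of all functions defined only inside some [A : set X].
   Sending a closed set to this [A] is a bijection onto the power set of [X], along
   which the Boolean structure is transported. *)

Set Implicit Arguments.
Unset Strict Implicit.
Unset Printing Implicit Defensive.

Local Open Scope classical_set_scope.

Section Support.
Context {X : Type}.
Implicit Types (a : X -> three) (S I : set (X -> three)) (A B : set X).

Definition supp S : set X := [set x | exists2 a, S a & a x <> U3].

Definition supported A : set (X -> three) :=
  [set a | forall x, a x <> U3 -> A x].

(** Where [alpha] is [T3] or [F3], exactly one disjunct passes [a] through and the other is [F3], so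
    the disjunction equals [a]; where [alpha] is [U3], evaluation from the left gives [U3] whatever
    [a] is. *)
Lemma Ann1P a alpha :
  Ann1 a alpha <-> forall x, alpha x <> U3 -> a x = U3.
Proof.
split=> [ann x|ann].
  move: (congr1 (fun g => g x) ann).
  by rewrite /pw_or /pw_and /pw_neg /pw_U; case: (alpha x); case: (a x).
apply: funext => x; move: (ann x).
rewrite /pw_or /pw_and /pw_neg /pw_U.
by case: (alpha x); case: (a x) => // ->.
Qed.

Lemma Ann_supported S : Ann S = supported (~` supp S).
Proof.
apply/seteqP; split=> alpha /= ann.
  by move=> x alphax [a Sa]; apply; apply: (Ann1P a alpha).1 alphax; exact: ann.
move=> a Sa; apply/Ann1P => x alphax; apply: contrapT => ax.
by apply: (ann x alphax); exists a.
Qed.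

Lemma supp_supported A : supp (supported A) = A.
Proof.
apply/seteqP; split=> [x [a Aa ax]|x Ax]; first exact: Aa.
(* One function, defined on exactly [A], witnesses all points of [A] at once. *)
by exists (fun y => if `[< A y >] then T3 else U3) => [y|];
  case: asboolP.
Qed.

Lemma Ann_supportedC A : Ann (supported A) = supported (~` A).
Proof. by rewrite Ann_supported supp_supported. Qed.

Lemma supported_closed A : closed_sets X (supported A).
Proof. by rewrite /closed_sets /= !Ann_supportedC setCK. Qed.

Lemma supp_closedK I : closed_sets X I -> supported (supp I) = I.
(* Only the right-hand [I] is expanded to [Ann (Ann I)]; the two annihilators then complement
   [supp I] twice. *)
Proof. by move=> {2}<-; rewrite (Ann_supported I) Ann_supportedC setCK. Qed.

Lemma supportedI A B : supported (A `&` B) = supported A `&` supported B.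
Proof.
apply/seteqP; split=> a /=; last by move=> [aA aB] x ax; split; [exact: aA|exact: aB].
by move=> aAB; split=> x /aAB[].
Qed.

Lemma supported0 : supported set0 = [set pw_U].
Proof.
apply/seteqP; split=> a /=; last by move=> ->.
by move=> a0; apply: funext => x; apply: contrapT => /a0.
Qed.

Lemma supportedT : supported setT = setT.
Proof. by apply/seteqP; split. Qed.

End Support.

(* An alias, so that the instances below are not inferred for [closed_type X]
   itself, where they could take precedence over the structure named in the theorem. *)
Definition closed_algebra (X : Type) : Type := closed_type X.

HB.instance Definition _ (X : Type) := gen_eqMixin (closed_algebra X).
HB.instance Definition _ (X : Type) := gen_choiceMixin (closed_algebra X).

Section ClosedAlgebra.
Context {X : Type}.
Implicit Types (I J : closed_algebra X) (A : set X).

Definition closed_supp I : set X := supp (carrier I).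

Definition closed_of A : closed_algebra X :=
  exist _ (supported A) (mem_set (supported_closed A)).

Lemma closed_ofK : cancel closed_of closed_supp.
Proof. exact: supp_supported. Qed.

Lemma supported_closed_supp I : supported (closed_supp I) = carrier I.
Proof. exact/supp_closedK/set_mem/(svalP I). Qed.

Lemma closed_suppK : cancel closed_supp closed_of.
Proof. by move=> I; apply: (@val_inj _ _ (set_type (closed_sets X))); exact: supported_closed_supp. Qed.

(** This agrees with inclusion of carriers; comparing supports makes [closed_supp] an order
    embedding by definition. *)
Definition closed_le I J := (closed_supp I <= closed_supp J)%O.

Lemma closed_le_refl : reflexive closed_le.
Proof. by move=> I; exact: Order.POrderTheory.lexx. Qed.

Lemma closed_le_anti : antisymmetric closed_le.
Proof.
by move=> I J /Order.POrderTheory.le_anti; exact: (can_inj closed_suppK).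
Qed.

Lemma closed_le_trans : transitive closed_le.
Proof. by move=> I J K; exact: Order.POrderTheory.le_trans. Qed.

HB.instance Definition _ := Order.Le_isPOrder.Build set_display
  (closed_algebra X) closed_le_refl closed_le_anti closed_le_trans.

Lemma closed_supp_mono : {mono closed_supp : I J / (I <= J)%O}.
Proof. by []. Qed.

HB.instance Definition _ := Order.IsoDistrLattice.Build set_display
  (closed_algebra X) closed_suppK closed_ofK closed_supp_mono.

Lemma closed_le0 I : (closed_of set0 <= I)%O.
Proof. by rewrite -closed_supp_mono closed_ofK; exact: Order.le0x. Qed.

Lemma closed_le1 I : (I <= closed_of setT)%O.
Proof. by rewrite -closed_supp_mono closed_ofK; exact: Order.lex1. Qed.

HB.instance Definition _ :=
  Order.hasBottom.Build set_display (closed_algebra X) closed_le0.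
HB.instance Definition _ :=
  Order.hasTop.Build set_display (closed_algebra X) closed_le1.

(** The transported operations are by construction [closed_of] of the set operations on supports, so
    cancellation suffices here and for the join, the constants and the complement. *)
Lemma closed_supp_meet I J :
  closed_supp (I `&` J)%O = closed_supp I `&` closed_supp J.
Proof. exact: closed_ofK. Qed.

Lemma closed_supp_join I J :
  closed_supp (I `|` J)%O = closed_supp I `|` closed_supp J.
Proof. exact: closed_ofK. Qed.

Lemma closed_supp0 : closed_supp \bot%O = set0.
Proof. exact: closed_ofK. Qed.

Lemma closed_supp1 : closed_supp \top%O = setT.
Proof. exact: closed_ofK. Qed.

Definition closed_compl I := closed_of (~` closed_supp I).

Lemma closed_joinC I : (I `|` closed_compl I)%O = \top%O.
Proof.
apply: (can_inj closed_suppK).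
by rewrite closed_supp_join closed_supp1 closed_ofK setUCr.
Qed.

Lemma closed_meetC I : (I `&` closed_compl I)%O = \bot%O.
Proof.
apply: (can_inj closed_suppK).
by rewrite closed_supp_meet closed_supp0 closed_ofK setICr.
Qed.

HB.instance Definition _ := Order.TBDistrLattice_hasComplement.Build set_display
  (closed_algebra X) closed_joinC closed_meetC.

Lemma closed_supp_compl I : closed_supp (~` I)%O = ~` closed_supp I.
Proof. exact: closed_ofK. Qed.

HB.instance Definition _ := Order.isOrderMorphism.Build _ (closed_algebra X) _
  (set X) closed_supp (fun I J => id).
HB.instance Definition _ := Order.isLatticeMorphism.Build _ (closed_algebra X) _
  (set X) closed_supp closed_supp_meet closed_supp_join.
HB.instance Definition _ := Order.isBLatticeMorphism.Build _ (closed_algebra X) _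
  (set X) closed_supp closed_supp0.
HB.instance Definition _ := Order.isTLatticeMorphism.Build _ (closed_algebra X) _
  (set X) closed_supp closed_supp1.

(** Bounds are computed on supports, by union and intersection; for the empty family these are
    [set0] and [setT], giving bottom and top. *)
Lemma closed_algebra_complete : complete_lattice (closed_algebra X).
Proof.
move=> F; split.
  exists (closed_of (\bigcup_(I in F) closed_supp I)); split=> [I FI|J ubJ].
    rewrite -closed_supp_mono closed_ofK; apply/subsetPset.
    exact: bigcup_sup.
  rewrite -closed_supp_mono closed_ofK; apply/subsetPset; apply: bigcup_sub => I FI.
  exact/subsetPset/ubJ.
exists (closed_of (\bigcap_(I in F) closed_supp I)); split=> [I FI|J lbJ].
  rewrite -closed_supp_mono closed_ofK; apply/subsetPset.
  exact: bigcap_inf.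
rewrite -closed_supp_mono closed_ofK; apply/subsetPset; apply: sub_bigcap => I FI.
exact/subsetPset/lbJ.
Qed.

End ClosedAlgebra.

Theorem theorem4p14 (X : Type) :
  exists c : Order.CTBDistrLattice.axioms_ set_display (closed_type X),
    let L : ctbDistrLatticeType set_display := Order.CTBDistrLattice.Pack c in
    [/\ [/\ forall I : L, carrier (Order.compl I) = Ann (carrier I),
            forall I1 I2 : L,
              carrier (Order.meet I1 I2) = (carrier I1 `&` carrier I2)%classic,
            forall I1 I2 : L,
              carrier (Order.join I1 I2)
              = Ann (Ann (carrier I1) `&` Ann (carrier I2))%classic,
            carrier (Order.bottom : L) = [set pw_U]%classic
          & carrier (Order.top : L) = [set: X -> three]%classic],
        exists f : {tblmorphism L -> set X},
          bijective f /\ (forall I : L, f (Order.compl I) = (~` f I)%classic)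
      & complete_lattice L].
Proof.
(* The alias unfolds to [closed_type X], so its class has the required type. *)
exists (Order.CTBDistrLattice.class (closed_algebra X)) => L.
split; last exact: closed_algebra_complete.
- split.
  (* Writing each carrier as [supported] of its support turns the identities into ones between
     subsets of [X]. *)
  + move=> I; rewrite -(supported_closed_supp (~` I)%O) closed_supp_compl.
    by rewrite -Ann_supportedC supported_closed_supp.
  + move=> I J; rewrite -(supported_closed_supp (I `&` J)%O) closed_supp_meet.
    by rewrite supportedI !supported_closed_supp.
  + move=> I J; rewrite -(supported_closed_supp (I `|` J)%O) closed_supp_join.
    rewrite -(supported_closed_supp I) -(supported_closed_supp J).
    (* Each [Ann] complements a support, so this is De Morgan's law. *)
    by rewrite !Ann_supportedC -supportedI Ann_supportedC -setCU setCK.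
  + by rewrite -supported0.
  + by rewrite -supportedT.
- exists (@closed_supp X : {tblmorphism closed_algebra X -> set X}); split.
    by exists closed_of; [exact: closed_suppK|exact: closed_ofK].
  exact: closed_supp_compl.
Qed.
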